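(* Let $m=m(n)$ be a function with $n \ll m = n^{1+o(1)}$. Then with high probability $$(1-o(1))\frac{m}{2} \le g(n,m) \le \frac{m}{2}.$$
   Context: $G(n,m)$ denotes a graph chosen uniformly at random from all labelled graphs on vertex set $[n]=\{1,\dots,n\}$ with exactly $m$ edges ($m=m(n)\ge 0$ an integer), and $g(n,m)$ is the genus of $G(n,m)$, i.e. the minimum number of handles that must be attached to a sphere so that the graph embeds without crossing edges. ''With high probability'' (whp) means with probability tending to $1$ as $n\to\infty$. $a \ll b$ means $a/b \to 0$ as $n\to\infty$. The statement $(1-o(1))\frac m2 \le g(n,m)$ whp means: for every constant $\epsilon>0$, $g(n,m) \ge (1-\epsilon)\frac m2$ whp. All asymptotics are as $n\to\infty$. *)

(* Defs.v *)
From HB Require Import structures.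
From mathcomp Require Import all_boot all_order all_fingroup all_algebra.
From mathcomp Require Import all_classical all_reals all_analysis.

Set Implicit Arguments.
Unset Strict Implicit.
Unset Printing Implicit Defensive.

Import Order.TTheory GRing.Theory Num.Theory.

(* A connected closed oriented surface, presented by a cell decomposition with
   at least one edge.  Darts are the oriented edges; [dart_rev] reverses a dart
   and [dart_rot] sends a dart to the next one, in the orientation of the
   surface, among those with the same initial vertex. *)
Record orientedMap := OrientedMap {
  dart : finType;
  dart_rev : {perm dart};
  dart_rot : {perm dart};
  dart_revK : involutive dart_rev;
  dart_rev_neq : forall d, dart_rev d != d;
  map_nonempty : 0 < #|dart|;
  map_connected : forall x y,
    connect [rel a b | (dart_rot a == b) || (dart_rev a == b)] x y
}.

Definition map_vertices (M : orientedMap) : {set {set dart M}} :=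
  porbits (dart_rot M).

Definition map_edges (M : orientedMap) : {set {set dart M}} :=
  porbits (dart_rev M).

(* The product of permutations composes left to right, so the successor of d
   along the boundary of its face is [dart_rot (dart_rev d)]. *)
Definition map_faces (M : orientedMap) : {set {set dart M}} :=
  porbits (dart_rev M * dart_rot M)%g.

(* The surface is a sphere with g handles: V - E + F = 2 - 2g. *)
Definition has_handles (M : orientedMap) (g : nat) : Prop :=
  #|map_vertices M| + #|map_faces M| + g.*2 = #|map_edges M| + 2.

(* A graph with vertex set T is given by its set E of 2-element edges.  It is
   drawn in M when its vertices are distinct vertices of M and its edges are
   edges of M; other vertices and edges of M may be left unused, so the faces of
   the drawing itself need not be discs and the graph need not be connected.
   Different edges of E are automatically carried by different edges of M, since
   they have different pairs of ends. *)
Definition drawn_in (T : finType) (E : {set {set T}}) (M : orientedMap) : Prop :=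
  exists f : T -> {set dart M},
    [/\ injective f,
        forall u, f u \in map_vertices M
      & forall u v, [set u; v]%SET \in E ->
          exists2 d, d \in f u & dart_rev M d \in f v].

Definition embeds_with_handles (T : finType) (E : {set {set T}}) (g : nat) :=
  exists2 M : orientedMap, has_handles M g & drawn_in E M.

Definition is_genus (T : finType) (E : {set {set T}}) (g : nat) : Prop :=
  embeds_with_handles E g /\
  forall h, embeds_with_handles E h -> g <= h.

(* The default 0 is never used: every finite graph embeds in some surface. *)
Definition genus (T : finType) (E : {set {set T}}) : nat :=
  xget 0 (is_genus E).

(* Vertices are labelled 0, ..., n-1. *)
Definition graphs (n m : nat) : {set {set {set 'I_n}}} :=
  [set E : {set {set 'I_n}} |
    (E \subset [set e : {set 'I_n} | #|e| == 2]) && (#|E| == m)]%SET.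

Definition Pr_Gnm (R : realType) (n m : nat) (A : pred {set {set 'I_n}}) : R :=
  (#|[set E in graphs n m | A E]%SET|%:R / #|graphs n m|%:R)%R.
Arguments Pr_Gnm R n m A : clear implicits.

(* Main.v *)
(* Upper bound: add to E a spanning star and rotate arbitrarily at each vertex.
   The resulting map is connected, has n vertices, at most m + n - 1 edges and at
   least one face, so 2 g <= m by Euler's formula.

   Lower bound: deleting from a map the edges outside E gives
   m <= 2 g + n + F, where F counts the faces of the drawing of E.  Fix L.  At
   most 2 m / L faces have more than L darts.  A face containing the reverse of
   each of its darts exhausts its component, so there are at most n of these.  Any
   other short face has a dart whose reverse lies elsewhere, hence closes up to a
   cycle of length at most L through that dart, and the cycle determines the face.
   The expected number of cycles of length k in G(n, m) is at most (4 m / n)^k,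
   which is n^o(1) = o(m) when m = n^(1 + o(1)); conclude by Markov's
   inequality. *)
Require Import Defs.
From HB Require Import structures.
From mathcomp Require Import all_boot all_order all_fingroup all_algebra.
From mathcomp Require Import zify.
Set Implicit Arguments.
Unset Strict Implicit.
Unset Printing Implicit Defensive.
Import Order.TTheory GRing.Theory Num.Theory.

(** * Orbits of a permutation multiplied by transpositions *)

Lemma porbit_invariant (D : finType) (K : Type) (s : {perm D}) (lam : D -> K) :
  (forall z, lam (s z) = lam z) -> forall x y, x \in porbit s y -> lam x = lam y.
Proof.
move=> inv x y /porbitP[i ->]; rewrite permX.
by elim: i => //= i; rewrite inv.
Qed.

Lemma porbit_step (D : finType) (s : {perm D}) x : porbit s (s x) = porbit s x.
Proof. exact: (porbit_perm s 1). Qed.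

Lemma leq_cardsD (T : finType) (A B : {set T}) : #|A| <= #|A :\: B| + #|B|.
Proof.
rewrite -[X in X <= _](cardsID B A) addnC leq_add2l.
exact/subset_leq_card/subsetIr.
Qed.

Section Merge.
Variables (D K : finType) (s : {perm D}).

(** If the labels of [x] and [y] agree, they can stay and at most one orbit is gained. If they
    differ, two orbits are joined: one orbit and at most one label are lost, and as labels count
    twice, the excess of orbits over labels still grows by at most one. *)
Lemma merge_labels_tperm (lam : D -> K) (x y : D) :
  (forall z, lam (s z) = lam z) ->
  exists lam' : D -> K,
    [/\ forall z w, lam z = lam w -> lam' z = lam' w,
        lam' x = lam' y,
        forall z, lam' ((tperm x y * s)%g z) = lam' z
      & #|porbits (tperm x y * s)| + 2 * #|lam @: D| <=
          #|porbits s| + 1 + 2 * #|lam' @: D|].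
Proof.
move=> inv; have := porbits_mul_tperm s x y.
case: (eqVneq (lam x) (lam y)) => [exy | nxy].
  move=> eqp; exists lam; split=> //; last by move: eqp; case: (x != y); lia.
  by move=> z; rewrite permM inv; case: tpermP => [->|->|//].
have -> : x \notin porbit s y.
  by apply: contra nxy => /(porbit_invariant inv) ->.
have -> : x != y by apply: contraNneq nxy => ->.
move=> eqp; exists (fun z => if lam z == lam y then lam x else lam z); split.
- by move=> z w ->.
- by rewrite eqxx (negPf nxy).
- move=> z; rewrite permM inv; case: tpermP => [->|->|//]; rewrite eqxx.
    by rewrite (negPf nxy).
  by rewrite (negPf nxy).
set lam' := fun z => _.
suff : #|lam @: D| <= #|lam' @: D|.+1 by move: eqp; lia.
have /subset_leq_card : lam @: D \subset lam y |: lam' @: D.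
  apply/subsetP=> _ /imsetP[z _ ->]; rewrite !inE.
  case: eqP => //= zy; apply/imsetP; exists z => //.
  by rewrite /lam'; case: eqP.
by move/leq_trans; apply; rewrite cardsU1; case: (_ \notin _); lia.
Qed.

End Merge.

Section Twist.
Variables (D : finType) (rev : {perm D}).
Hypothesis revK : involutive rev.

Lemma mem_porbit_invol x y : (x \in porbit rev y) = (x == y) || (x == rev y).
Proof.
apply/porbitP/orP => [[i ->]|[/eqP->|/eqP->]].
- rewrite permX; elim: i => [|i] /=; first by rewrite eqxx; left.
  by case=> /eqP ->; [right | left; rewrite revK].
- by exists 0; rewrite permX.
- by exists 1; rewrite permX.
Qed.

(** Inserts edges one at a time: swapping the two darts of an edge before applying [rot] turns the
    rotation into the face permutation along that edge. *)
Definition twist (rot : {perm D}) (l : seq D) : {perm D} :=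
  foldr (fun d s => tperm d (rev d) * s)%g rot l.

(** Distinct edges have disjoint sets of darts, so at most one of the transpositions moves [x]. *)
Lemma twistE rot l x : uniq [seq porbit rev d | d <- l] ->
  twist rot l x =
    rot (if porbit rev x \in [seq porbit rev d | d <- l] then rev x else x).
Proof.
elim: l x => //= d l IH x /andP[dl ul]; rewrite permM IH // inE.
case: tpermP => [->|->|/eqP xd /eqP xrd].
- by rewrite porbit_step (negPf dl) eqxx.
- by rewrite porbit_step (negPf dl) eqxx revK.
- by rewrite eq_porbit_mem mem_porbit_invol (negPf xd) (negPf xrd).
Qed.

Lemma twist_cat rot l1 l2 : twist rot (l1 ++ l2) = twist (twist rot l2) l1.
Proof. by rewrite /twist foldr_cat. Qed.

Lemma merge_labels_twist (K : finType) (s : {perm D}) (lam : D -> K) (l : seq D) :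
  (forall z, lam (s z) = lam z) ->
  exists lam' : D -> K,
    [/\ forall z w, lam z = lam w -> lam' z = lam' w,
        forall d, d \in l -> lam' (rev d) = lam' d,
        forall z, lam' (twist s l z) = lam' z
      & #|porbits (twist s l)| + 2 * #|lam @: D| <=
          #|porbits s| + size l + 2 * #|lam' @: D|].
Proof.
move=> inv; elim: l => [|d l [lam1 [coarse1 rev1 inv1 card1]]] /=.
  by exists lam; split=> //; rewrite addn0.
have [lam2 [coarse2 rev2 inv2 card2]] := merge_labels_tperm d (rev d) inv1.
exists lam2; split=> //; first by move=> z w /coarse1/coarse2.
  by move=> z; rewrite inE => /predU1P[->//|/rev1/coarse2].
by move: card1 card2; rewrite /twist /=; lia.
Qed.

End Twist.

(** * Euler's formula for maps and for drawings inside them *)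

Section Euler.
Variable M : orientedMap.
Let rev := dart_rev M.
Let rot := dart_rot M.
Let revK : involutive rev := @dart_revK M.

Definition edge_darts (l : seq (dart M)) : {set dart M} :=
  [set x | porbit rev x \in [seq porbit rev d | d <- l]].

(* Reading the unused edges as fixed points of the edge involution, rather than
   deleting them, keeps the dart set fixed when passing to a subgraph: a face of
   the drawing of [l] is an orbit of [drawing_face l] meeting [edge_darts l]. *)
Definition drawing_face (l : seq (dart M)) : {perm dart M} := twist rev rot l.

Lemma drawing_faceE l x : uniq [seq porbit rev d | d <- l] ->
  drawing_face l x = rot (if x \in edge_darts l then rev x else x).
Proof. by move=> ul; rewrite /drawing_face twistE // inE. Qed.

Lemma rev_edge_darts l x : (rev x \in edge_darts l) = (x \in edge_darts l).
Proof. by rewrite !inE porbit_step. Qed.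

Lemma edge_transversal (l : seq (dart M)) : uniq [seq porbit rev d | d <- l] ->
  exists r, [/\ uniq [seq porbit rev d | d <- r ++ l],
    [seq porbit rev d | d <- r ++ l] =i map_edges M &
    size r + size l = #|map_edges M| ].
Proof.
move=> ul; set A := [set O in [seq porbit rev d | d <- l]].
have [r rP] : exists r, [seq porbit rev d | d <- r] = enum (map_edges M :\: A).
  have : {subset enum (map_edges M :\: A) <= map_edges M}.
    by move=> O; rewrite mem_enum inE => /andP[].
  elim: (enum _) => [|O s IH] sub; first by exists [::].
  have [r <-] := IH (fun x xs => sub x (@mem_behead _ (O :: s) x xs)).
  have /imsetP[d _ ->] := sub O (mem_head _ _).
  by exists (d :: r).
exists r; rewrite map_cat rP.
have sA : A \subset map_edges M.
  by apply/subsetP=> O; rewrite inE => /mapP[d _ ->]; apply: imset_f.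
have cA : #|A| = size l by rewrite cardsE (card_uniqP ul) size_map.
split.
- rewrite cat_uniq enum_uniq ul andbT; apply/hasPn => O Ol.
  by rewrite /= mem_enum !inE Ol.
- move=> O; rewrite mem_cat mem_enum !inE.
  case: (boolP (O \in _)) => [Ol|]; last by rewrite /= orbF.
  by rewrite orbT; symmetry; move: (subsetP sA O); rewrite inE; apply.
- rewrite -(size_map (porbit rev)) rP -cardE -cA cardsD (setIidPr sA).
  by rewrite subnK // subset_leq_card.
Qed.

(* The faces of a connected map arise from those of a sub-drawing by inserting
   the missing edges one at a time; [lam] labels the components. *)
Lemma faces_le_drawing (K : finType) (lam : dart M -> K) l :
  uniq [seq porbit rev d | d <- l] ->
  (forall z, lam (rot z) = lam z) ->
  (forall z, z \in edge_darts l -> lam (rev z) = lam z) ->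
  #|map_faces M| + 2 * #|lam @: dart M| + size l
    <= #|porbits (drawing_face l)| + #|map_edges M| + 2.
Proof.
move=> ul rotl revl.
have inv z : lam (drawing_face l z) = lam z.
  by rewrite drawing_faceE // rotl; case: ifP => // /revl.
have [r [url rlE <-]] := edge_transversal ul.
have [lam' [coarse rev' inv' card']] := merge_labels_twist rev r inv.
have -> : #|map_faces M| = #|porbits (twist rev (drawing_face l) r)|.
  rewrite /drawing_face -twist_cat; congr #|porbits _|; apply/permP => x.
  by rewrite twistE // rlE permM imset_f.
(* Once all edges are inserted, the labels are constant along rotation and reversal, so
   connectedness leaves a single one; it accounts for the constant 2. *)
suff : #|lam' @: dart M| <= 1 by lia.
have rotl' z : lam' (rot z) = lam' z by apply: coarse.
have revl' z : lam' (rev z) = lam' z.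
  have : porbit rev z \in [seq porbit rev d | d <- r ++ l] by rewrite rlE imset_f.
  rewrite map_cat mem_cat => /orP[/mapP[d dr]|zl].
    move/eqP; rewrite eq_porbit_mem mem_porbit_invol // => /orP[]/eqP ->.
      exact: rev'.
    by rewrite revK rev'.
  by apply/coarse/revl; rewrite inE.
apply/card_le1_eqP => _ _ /imsetP[x _ ->] /imsetP[y _ ->].
have /connectP[p pth ->] := map_connected x y.
elim: p x pth => //= a p IH x /andP[/orP[]/eqP <- /IH ->] //.
Qed.

(** Start from the empty drawing: its face permutation is the rotation, so each vertex is one orbit
    and carries its own label. *)
Lemma euler_le : #|map_vertices M| + #|map_faces M| <= #|map_edges M| + 2.
Proof.
suff : #|map_faces M| + 2 * #|map_vertices M| + 0 <=
  #|map_vertices M| + #|map_edges M| + 2 by lia.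
apply: (@faces_le_drawing _ (porbit rot) [::]) => // z; last by rewrite inE.
exact: porbit_step.
Qed.

(** The Euler characteristic is even: the face permutation is the rotation times one transposition
    per edge, and the sign of a permutation is given by the parity of the number of darts minus the
    number of orbits. *)
Lemma exists_handles : exists g, has_handles M g.
Proof.
have le := euler_le.
have [r [ur rE _]] := @edge_transversal [::] isT.
rewrite cats0 in ur rE.
have fE : (rev * rot)%g = twist rev rot r.
  by apply/permP => x; rewrite twistE // rE permM imset_f.
(* Reversal has no fixed dart, so every transposition is genuine and flips the sign. *)
have par : odd_perm (twist rev rot r) = odd (size r) (+) odd_perm rot.
  elim: r {ur rE fE} => //= d r IH.
  by rewrite odd_mul_tperm IH eq_sym dart_rev_neq addbA.
exists ((#|map_edges M| + 2 - (#|map_vertices M| + #|map_faces M|))./2).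
rewrite /has_handles even_halfK ?subnKC // oddB // !oddD.
move: par; rewrite -fE /odd_perm -/(map_faces M) -/(map_vertices M).
have <- : size r = #|map_edges M|.
  by rewrite -(size_map (porbit rev)) -(card_uniqP ur); apply/esym/eq_card.
by case: (odd #|dart M|); case: (odd (size r)); case: (odd _); case: (odd _).
Qed.

(** An untouched vertex contributes one vertex and at most one orbit of [drawing_face l]; its label,
    counted twice, cancels both. Only touched vertices and faces of the drawing remain. *)
Lemma drawing_genus_ge g (l : seq (dart M)) : has_handles M g ->
  uniq [seq porbit rev d | d <- l] ->
  size l <= 2 * g + #|[set porbit rot x | x in edge_darts l]|
            + #|[set porbit (drawing_face l) x | x in edge_darts l]|.
Proof.
rewrite /has_handles => hg ul.
set T := [set porbit rot x | x in _]; set F := [set porbit _ x | x in _].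
set S := edge_darts l.
(* One common label [set0] for all touched vertices is invariant along the edges of [l] whatever the
   components of the drawing are. *)
pose lam x := if porbit rot x \in T then set0 else porbit rot x.
have H : #|map_faces M| + 2 * #|lam @: dart M| + size l <=
  #|porbits (drawing_face l)| + #|map_edges M| + 2.
  apply: faces_le_drawing => // z; first by rewrite /lam porbit_step.
  move=> zS; rewrite /lam.
  by rewrite !(imset_f (porbit rot)) // rev_edge_darts.
have VT : #|map_vertices M :\: T| <= #|lam @: dart M|.
  apply/subset_leq_card/subsetP => O; rewrite inE => /andP[OT /imsetP[x _ Ox]].
  by apply/imsetP; exists x => //; rewrite /lam -Ox (negPf OT).
(* An orbit avoiding [S] never reverses a dart, so it is the rotation orbit of an untouched
   vertex. *)
have FV : #|porbits (drawing_face l) :\: F| <= #|map_vertices M :\: T|.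
  apply/subset_leq_card/subsetP => O; rewrite inE => /andP[OF /imsetP[x _ Ox]].
  have OS y : y \in O -> y \notin S.
    move=> yO; apply: contra OF => yS; rewrite Ox; apply/imsetP; exists y => //.
    by apply/eqP; rewrite eq_porbit_mem porbit_sym -Ox.
  have fX i : (drawing_face l ^+ i)%g x = (rot ^+ i)%g x.
    elim: i => [|i IH]; first by rewrite !expg0.
    rewrite !expgSr !permM IH drawing_faceE // ifN //.
    by apply: OS; rewrite -IH Ox mem_porbit.
  have Or : O = porbit rot x.
    by apply/setP => y; rewrite Ox; apply/porbitP/porbitP => -[i ->]; exists i; rewrite fX.
  rewrite inE Or; apply/andP; split; last exact: imset_f.
  apply/imsetP => -[y yS xy].
  have yO : y \in O by rewrite Or xy porbit_id.
  by move: (OS y yO); rewrite yS.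
have sT : #|map_vertices M| <= #|map_vertices M :\: T| + #|T|.
  exact: leq_cardsD.
have sF : #|porbits (drawing_face l)| <= #|porbits (drawing_face l) :\: F| + #|F|.
  exact: leq_cardsD.
by move: hg H VT FV sT sF; rewrite -addnn; lia.
Qed.

End Euler.

(** * Counting the faces of a drawing by short cycles *)

Definition simple_cycles (T : finType) (e : rel T) (k : nat) : {set k.-tuple T} :=
  [set c : k.-tuple T | uniq c && path.cycle e c].

Lemma leq_card_bigcup (I T : finType) (P : pred I) (A : I -> {set T}) :
  #|\bigcup_(i | P i) A i| <= \sum_(i | P i) #|A i|.
Proof.
elim/big_rec2: _ => [|i n B _ IH]; first by rewrite cards0.
by rewrite (leq_trans (leq_card_setU _ _)) // leq_add2l.
Qed.

Section Faces.
Variables (D T : finType) (rev rot phi : {perm D}) (S : {set D}).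
Variables (src : D -> T) (e : rel T).
Hypothesis revK : involutive rev.
Hypothesis revS : forall x, (rev x \in S) = (x \in S).
Hypothesis phiE : forall x, phi x = rot (if x \in S then rev x else x).
Hypothesis src_rot : forall x, src (rot x) = src x.
Hypothesis src_inj : forall x y, x \in S -> y \in S ->
  src x = src y -> y \in porbit rot x.
Hypothesis simple_edge : forall x y, x \in S -> y \in S ->
  src x = src y -> src (rev x) = src (rev y) -> x = y.
Hypothesis loopless : forall x, x \in S -> src x != src (rev x).
Hypothesis adjacent : forall x, x \in S -> e (src x) (src (rev x)).

Let faces := [set porbit phi x | x in S].

Lemma card_touched_vertices : #|[set porbit rot x | x in S]| <= #|T|.
Proof.
pose g u := odflt set0 (omap (porbit rot) [pick x in S | src x == u]).
apply: (@leq_trans #|g @: T|); last exact: leq_imset_card.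
apply/subset_leq_card/subsetP => _ /imsetP[x xS ->].
apply/imsetP; exists (src x) => //; rewrite /g.
case: pickP => [y /andP[yS /eqP yx]|/(_ x)] /=; last by rewrite xS eqxx.
by apply/eqP; rewrite eq_porbit_mem; apply: src_inj.
Qed.

Definition long_faces L := [set O in faces | L < #|O :&: S|].

Lemma card_long_faces L : #|long_faces L| * L <= #|S|.
Proof.
have triv : trivIset (long_faces L).
  apply/trivIsetP => A B; rewrite !inE => /andP[/imsetP[x _ ->] _].
  case/andP=> /imsetP[y _ ->] _; apply: contraR => /pred0Pn[z /= /andP[zx zy]].
  apply/eqP; transitivity (porbit phi z).
    by apply/eqP; rewrite eq_porbit_mem porbit_sym.
  by apply/eqP; rewrite eq_porbit_mem.
apply: (@leq_trans #|cover (long_faces L) :&: S|); last first.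
  exact/subset_leq_card/subsetIr.
rewrite /cover.
have -> : #|\bigcup_(B in long_faces L) B :&: S| =
   \sum_(B in long_faces L) #|B :&: S|.
  rewrite -!sum1_card.
  under [RHS]eq_bigr do rewrite -sum1_card.
  rewrite (eq_bigl (fun x => (x \in cover (long_faces L)) && (x \in S))); last first.
    by move=> x; rewrite inE.
  rewrite big_trivIset_cond //=.
  by apply: eq_bigr => A _; apply: eq_bigl => x; rewrite inE.
rewrite -sum_nat_const; apply: leq_sum => B; rewrite inE => /andP[_ /ltnW //].
Qed.

(** These faces have every edge of their boundary on both sides, as the face of a plane tree
    does. *)
Definition tree_faces :=
  [set O in faces | [forall x in O :&: S, rev x \in O]].

(** Such a face is closed under the rotation, so it contains a whole touched vertex. As faces are
    disjoint, it is recovered from that vertex as the union [h] of all tree faces containing it. *)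
Lemma card_tree_faces : #|tree_faces| <= #|T|.
Proof.
apply: leq_trans card_touched_vertices.
(* For [z] in [S] the dart [rot z] is [phi (rev z)], with [rev z] in [O]; otherwise it is
   [phi z]. *)
have closed O x : O \in tree_faces -> x \in O -> porbit rot x \subset O.
  rewrite inE => /andP[/imsetP[y yS ->] /forall_inP cl] xO.
  have phiO z : z \in porbit phi y -> phi z \in porbit phi y.
    by rewrite -!eq_porbit_mem => /eqP <-; rewrite porbit_step.
  apply/subsetP => _ /porbitP[i ->].
  elim: i => [|i]; first by rewrite expg0 perm1.
  rewrite expgSr permM; set z := fun_of_perm (rot ^+ i)%g x => IH.
  case: (boolP (z \in S)) => zS; last by have := phiO z IH; rewrite phiE ifN.
  have := phiO _ (cl z _); rewrite inE IH zS => /(_ isT).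
  by rewrite phiE revS zS revK.
pose h (V : {set D}) := \bigcup_(O in tree_faces | V \subset O) O.
apply: (@leq_trans #|h @: [set porbit rot x | x in S]|); last exact: leq_imset_card.
apply/subset_leq_card/subsetP => O Ot.
have [x xS Ox] : exists2 x, x \in S & O = porbit phi x.
  by move: Ot; rewrite inE => /andP[/imsetP].
apply/imsetP; exists (porbit rot x); first exact: imset_f.
apply/eqP; rewrite eqEsubset; apply/andP; split.
  apply: (bigcup_sup O); rewrite Ot closed // Ox porbit_id //.
apply/bigcupsP => O' /andP[O't xO'].
have xO : x \in O' by apply: (subsetP xO'); exact: porbit_id.
have /andP[/imsetP[y _ O'y] _] : (O' \in faces) && true.
  by move: O't; rewrite inE andbT => /andP[].
by rewrite Ox O'y; move: xO; rewrite O'y -eq_porbit_mem => /eqP ->.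
Qed.

(** At a dart outside [S] the map [phi] stays at the same vertex, so skipping these darts leaves a
    walk. The relation admits only darts of [O] in their own direction, which later rules out going
    back along a dart whose reverse is not in [O]. *)
Lemma facial_walk (O : {set D}) z j : (forall y, y \in O -> phi y \in O) -> z \in O ->
  let w := [seq src (rev y) | y <- traject phi z j & y \in S] in
  [/\ path [rel a b | [exists y in O :&: S, (src y == a) && (src (rev y) == b)]]
        (src z) w,
      last (src z) w = src (iter j phi z)
    & {subset w <= [set src (rev y) | y in O :&: S]}].
Proof.
move=> phiO; elim: j z => //= j IH z zO; have [p1 p2 p3] := IH _ (phiO _ zO).
case: ifP => zS.
  have sz : src (phi z) = src (rev z) by rewrite phiE zS src_rot.
  rewrite /= -sz p1 p2 andbT -iterSr; split => //.
    by apply/existsP; exists z; rewrite inE zO zS sz !eqxx.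
  move=> a; rewrite inE => /predU1P[->|/p3 //].
  by apply/imsetP; exists z; rewrite ?sz // inE zO.
have sz : src (phi z) = src z by rewrite phiE zS src_rot.
by rewrite -sz p1 p2 -iterSr.
Qed.

(* A dart whose reverse lies on another face is traversed in one direction only
   by the boundary walk, so the rest of that walk closes it up to a cycle. *)
Lemma facial_cycle O x : O \in faces -> x \in O :&: S -> rev x \notin O ->
  exists c : seq T, [/\ uniq c, path.cycle e c, 2 < size c <= #|O :&: S|,
    head (src x) c = src (rev x) & last (src x) c = src x].
Proof.
move=> Of xOS rxO; have /andP[xO xS] : (x \in O) && (x \in S) by rewrite -in_setI.
have phiO z : z \in O -> phi z \in O.
  by case/imsetP: Of => y _ ->; rewrite -!eq_porbit_mem => /eqP <-; rewrite porbit_step.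
(* The walk begins at [phi x] and makes the remaining steps of the orbit, so it leads from the end
   of [x] back to its source; loops are then cut out of it. *)
have [p1 p2 p3] := facial_walk #|porbit phi x|.-1 phiO (phiO x xO).
move: p1 p2 p3; set w := map _ _.
rewrite -iterSr prednK; last by apply/card_gt0P; exists x; exact: porbit_id.
rewrite iter_porbit.
have -> : src (phi x) = src (rev x) by rewrite phiE xS src_rot.
move=> p1 p2 p3; move: p2; case/shortenP: p1 => p pth up sub lst.
exists (src (rev x) :: p); split => //=.
- rewrite rcons_path lst adjacent // andbT.
  apply: sub_path pth => a b /existsP[y /andP[]]; rewrite inE => /andP[_ yS].
  by case/andP=> /eqP <- /eqP <-; apply: adjacent.
- apply/andP; split.
    (* Length 1 would make [x] a loop. Length 2 would need a dart of [O] with the ends of [rev x],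
       which by simplicity is [rev x] itself. *)
    case: p pth up sub lst => [|a [|b p]] //=.
      by move=> _ _ _ /esym /eqP; rewrite (negPf (loopless xS)).
    rewrite andbT => /existsP[y /andP[]]; rewrite inE => /andP[yO yS].
    case/andP=> /eqP ya /eqP yb _ _ ax.
    suff yx : y = rev x by rewrite -yx yO in rxO.
    by apply: simple_edge; rewrite ?revS ?revK ?yb.
  apply: (@leq_trans #|[set src (rev y) | y in O :&: S]|); last exact: leq_imset_card.
  rewrite -[_.+1]/(size (src (rev x) :: p)) -(card_uniqP up).
  apply/subset_leq_card/subsetP => a; rewrite inE => /predU1P[->|/sub/p3 //].
  exact: imset_f.
Qed.

(** Every face is long, a tree face, or closes up to a cycle of length at most [L]; the bound is
    multiplied by [L] to avoid a quotient. *)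
Lemma card_faces L : #|faces| * L <=
  #|S| + (#|T| + \sum_(k < L.+1 | 2 < k) #|simple_cycles e k|) * L.
Proof.
pose bad k := [set O in faces | [exists x in S, (x \in O) && [exists c : k.-tuple T,
  [&& c \in simple_cycles e k, head (src x) c == src (rev x) & last (src x) c == src x]]]].
have cbad k : 2 < k -> #|bad k| <= #|simple_cycles e k|.
  move=> k3.
  (* A tuple has a starting point and a direction, so it singles out the closing step from its last
     entry to its first. Simplicity allows only one dart there, and that dart lies on only one
     face. *)
  pose g (c : k.-tuple T) := odflt set0 (omap (porbit phi)
    [pick x in S | (head (src x) c == src (rev x)) && (last (src x) c == src x)]).
  apply: (@leq_trans #|g @: simple_cycles e k|); last exact: leq_imset_card.
  apply/subset_leq_card/subsetP => O; rewrite inE => /andP[Of].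
  case/existsP=> x /and3P[xS xO /existsP[c /and3P[cs hc lc]]].
  apply/imsetP; exists c => //; rewrite /g; case: pickP => [y|/(_ x)]; last first.
    by rewrite xS hc lc.
  case/and3P=> yS hy ly /=.
  have -> : y = x.
    have : 2 < size c by rewrite size_tuple.
    move: hc lc hy ly; case: (tval c) => //= c0 c' /eqP hc /eqP lc /eqP hy /eqP ly _.
    by apply: simple_edge => //; [rewrite -ly lc | rewrite -hy hc].
  by case/imsetP: Of xO => z _ ->; rewrite -eq_porbit_mem => /eqP ->.
have cov : #|faces| <= #|long_faces L| + (#|tree_faces| +
    \sum_(k < L.+1 | 2 < k) #|simple_cycles e k|).
  have sub : faces \subset long_faces L :|:
     (tree_faces :|: \bigcup_(k < L.+1 | 2 < k) bad k).
    apply/subsetP => O Of; rewrite !inE Of /=.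
    case: ltnP => //= OL; case: (boolP [forall _ in _, _]) => //=.
    case/forall_inPn => x xOS xO.
    have [c [uc cc /andP[c3 cO] hc lc]] := facial_cycle Of xOS xO.
    have cL : size c < L.+1 by rewrite ltnS (leq_trans cO).
    apply/bigcupP; exists (Ordinal cL) => //; rewrite inE Of /=.
    move: xOS; rewrite inE => /andP[xO' xS].
    apply/existsP; exists x; rewrite xS xO' /=; apply/existsP; exists (in_tuple c).
    by rewrite inE /= uc cc hc lc !eqxx.
  apply: leq_trans (subset_leq_card sub) _.
  rewrite (leq_trans (leq_card_setU _ _)) // leq_add2l.
  rewrite (leq_trans (leq_card_setU _ _)) // leq_add2l.
  rewrite (leq_trans (leq_card_bigcup _ _)) //.
  by apply: leq_sum => k; apply: cbad.
have := card_long_faces L; have := card_tree_faces; nia.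
Qed.

End Faces.

(** * Lower bound for the genus of a fixed graph *)

Definition adjacency (T : finType) (E : {set {set T}}) : rel T :=
  [rel u v | [set u; v] \in E].

(** Of the two terms [#|T|], one bounds the touched vertices and the other the tree faces;
    [2 * #|E|] is the number of darts shared among long faces. *)
Lemma embedding_lower_bound (T : finType) (E : {set {set T}}) g L :
  (forall e, e \in E -> #|e| = 2) -> embeds_with_handles E g ->
  #|E| * L <= 2 * #|E| +
    (2 * g + 2 * #|T| + \sum_(k < L.+1 | 2 < k) #|simple_cycles (adjacency E) k|) * L.
Proof.
move=> E2 [M hg [f [finj fV fE]]].
have [->|[e0 /[dup] e0E /E2 e02]] := set_0Vmem E; first by rewrite cards0.
have /card_gt0P[t0 _] : 0 < #|e0| by rewrite e02.
pose rev := dart_rev M; pose rot := dart_rot M.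
have revK : involutive rev := @dart_revK M.
have fO x u : x \in f u -> f u = porbit rot x.
  by case/imsetP: (fV u) => y _ ->; rewrite -eq_porbit_mem => /eqP.
have fu x u v : x \in f u -> (x \in f v) = (v == u).
  move=> xu; apply/idP/eqP => [xv|->//]; apply: finj.
  by rewrite (fO _ _ xu) (fO _ _ xv).
pose ends (O : {set dart M}) := [set u | [exists x in O, x \in f u]].
have endsE x u : (u \in ends (porbit rev x)) = (x \in f u) || (rev x \in f u).
  rewrite inE; apply/exists_inP/orP => [[y]|[xu|xu]].
  - by rewrite mem_porbit_invol // => /orP[]/eqP ->; [left | right].
  - by exists x => //; apply: porbit_id.
  - by exists (rev x) => //; rewrite mem_porbit_invol // eqxx orbT.
have ends2 x u v : x \in f u -> rev x \in f v -> ends (porbit rev x) = [set u; v].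
  by move=> xu xv; apply/setP => w; rewrite endsE !inE (fu _ _ _ xu) (fu _ _ _ xv).
(* One dart is chosen for each edge of [E]; reading off the ends then enumerates [E] without
   repetition. *)
have [l lE] : exists l, [seq ends (porbit rev d) | d <- l] = enum E.
  have : {subset enum E <= E} by move=> e; rewrite mem_enum.
  elim: (enum E) => [|e s IH] sub; first by exists [::].
  have [r <-] := IH (fun x xs => sub x (@mem_behead _ (e :: s) x xs)).
  have eE := sub e (mem_head _ _).
  have /cards2P[u [v [_ ee]]] : #|e| == 2 by rewrite E2.
  have [d du dv] : exists2 d, d \in f u & dart_rev M d \in f v.
    by apply: fE; rewrite -ee.
  by exists (d :: r); rewrite /= (ends2 _ _ _ du dv) ee.
have szl : size l = #|E| by rewrite cardE -lE size_map.
have uel : uniq (map ends [seq porbit rev d | d <- l]).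
  by rewrite -map_comp lE enum_uniq.
have ul := map_uniq uel.
pose S := edge_darts l.
have inS x : x \in S -> porbit rev x \in [seq porbit rev d | d <- l] by rewrite inE.
have endsS x : x \in S -> exists u v,
    [/\ x \in f u, rev x \in f v, u != v & [set u; v] \in E].
  move=> /inS xl.
  have exE : ends (porbit rev x) \in E.
    by rewrite -mem_enum -lE (map_comp ends); apply: map_f.
  have /cards2P[u [v [uv ee]]] : #|ends (porbit rev x)| == 2 by rewrite E2.
  have := endsE x u; have := endsE x v; rewrite ee !inE !eqxx orbT /=.
  rewrite ee in exE => /esym /orP[xv|xv] /esym /orP[xu|xu].
  - by move: uv; rewrite -(fu _ _ _ xv) xu.
  - by exists v, u; split; rewrite // 1?eq_sym // setUC.
  - by exists u, v.
  - by move: uv; rewrite -(fu _ _ _ xv) xu.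
(* The default [t0] is taken only at vertices of [M] outside the drawing, where no dart of [S]
   starts. *)
pose src x := odflt t0 [pick u | x \in f u].
have srcE x u : x \in f u -> src x = u.
  move=> xu; rewrite /src; case: pickP => [v|/(_ u)]; last by rewrite xu.
  by rewrite (fu _ _ _ xu) => /eqP.
have src_rot x : src (rot x) = src x.
  rewrite /src; congr odflt; apply: eq_pick => u /=.
  by case/imsetP: (fV u) => y _ ->; rewrite -!eq_porbit_mem porbit_step.
have H1 x y : x \in S -> y \in S -> src x = src y -> y \in porbit rot x.
  move=> /endsS[u [_ [xu _ _ _]]] /endsS[v [_ [yv _ _ _]]].
  by rewrite (srcE _ _ xu) (srcE _ _ yv) -(fO _ _ xu) => ->.
have H2 x y : x \in S -> y \in S ->
  src x = src y -> src (rev x) = src (rev y) -> x = y.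
  move=> /[dup] xS /endsS[u [v [xu xv uv _]]] /[dup] yS /endsS[u' [v' [yu yv _ _]]].
  rewrite (srcE _ _ xu) (srcE _ _ yu) (srcE _ _ xv) (srcE _ _ yv) => uu vv.
  subst u' v'.
  (* On the chosen edges [ends] is injective, its values being distinct; the inverse looks up the
     position in the list. *)
  have eqO : porbit rev x = porbit rev y.
    apply: (@can_in_inj _ _ (mem [seq porbit rev d | d <- l]) ends
      (fun e => nth set0 [seq porbit rev d | d <- l]
         (index e (map ends [seq porbit rev d | d <- l])))).
    - move=> O Ol; rewrite -{2}(nth_index set0 Ol); congr nth.
      rewrite -{1}(nth_index set0 Ol) -(nth_map set0 set0) ?index_mem //.
      by rewrite index_uniq // size_map index_mem.
    - exact: inS.
    - exact: inS.
    - by rewrite (ends2 _ _ _ xu xv) (ends2 _ _ _ yu yv).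
  move/eqP: eqO; rewrite eq_porbit_mem mem_porbit_invol // => /orP[/eqP //|/eqP xy].
  by move: xu; rewrite xy (fu _ _ _ yv) (negPf uv).
have H3 x : x \in S -> src x != src (rev x).
  by move=> /endsS[u [v [xu xv uv _]]]; rewrite (srcE _ _ xu) (srcE _ _ xv).
have H4 x : x \in S -> adjacency E (src x) (src (rev x)).
  by move=> /endsS[u [v [xu xv uv uE]]]; rewrite (srcE _ _ xu) (srcE _ _ xv).
have cS : #|S| <= 2 * #|E|.
  apply: (@leq_trans #|[set x in l ++ map rev l]|).
    apply/subset_leq_card/subsetP => x /inS /mapP[d dl] /eqP.
    rewrite eq_porbit_mem mem_porbit_invol // inE mem_cat => /orP[]/eqP ->.
      by rewrite dl.
    by rewrite map_f ?orbT.
  by rewrite cardsE (leq_trans (card_size _)) // size_cat size_map szl; lia.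
have revS x : (rev x \in S) = (x \in S) by apply: rev_edge_darts.
have hF := card_faces revK revS (fun x => drawing_faceE x ul) src_rot H1 H2 H3 H4 L.
have hV := leq_mul (card_touched_vertices H1) (leqnn L).
have := leq_mul (drawing_genus_ge hg ul) (leqnn L); rewrite szl !mulnDl in hF hV *.
move: hF hV; rewrite -!/rot -!/rev -!/S; lia.
Qed.

(** * Upper bound for the genus from a spanning star *)

(** Supplies an arbitrary rotation with prescribed vertices: each fibre is enumerated and permuted
    cyclically. *)
Lemma exists_fibre_perm (D : finType) (F : eqType) (h : D -> F) :
  exists s : {perm D}, forall x y, (x \in porbit s y) = (h x == h y).
Proof.
pose c x := enum [pred z | h z == h x].
have memc x z : (z \in c x) = (h z == h x) by rewrite mem_enum inE.
have c_eq x y : h x = h y -> c x = c y by move=> e; rewrite /c e.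
pose s0 x := next (c x) x.
have hs0 x : h (s0 x) = h x by apply/eqP; rewrite -memc mem_next memc.
have inj : injective s0.
  move=> x y e; have exy : h x = h y by rewrite -hs0 e hs0.
  have uc : uniq (c y) by apply: enum_uniq.
  move: e; rewrite /s0 (c_eq _ _ exy) => /(congr1 (prev (c y))).
  by rewrite !prev_next.
exists (perm inj) => x y; apply/idP/eqP => [|exy].
  by apply: porbit_invariant => z; rewrite permE.
have uc : uniq (c y) by apply: enum_uniq.
have cyc : fcycle s0 (c y).
  rewrite -(eq_in_cycle (P := mem (c y)) (e := frel (next (c y)))).
  - exact: cycle_next.
  - by move=> a b; rewrite memc /= => /eqP ay _; rewrite /s0 (c_eq _ _ ay).
  - exact/allP.
have : fconnect s0 y x.
  by rewrite (fconnect_cycle cyc) ?memc ?exy.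
move/iter_findex => <-; apply/porbitP; exists (findex s0 y x).
by rewrite permX; apply: eq_iter => z; rewrite permE.
Qed.

Section StarEmbedding.
Variables (T : finType) (E : {set {set T}}) (t0 : T).
Hypothesis E2 : forall e, e \in E -> #|e| = 2.
Hypothesis T2 : 1 < #|T|.

Let E' := E :|: [set [set t0; v] | v in [set~ t0]].
Let D := {p : T * T | (p.1 != p.2) && ([set p.1; p.2] \in E')}.

Lemma star_dart (u v : T) : u != v -> [set u; v] \in E' -> {d : D | val d = (u, v)}.
Proof.
move=> uv uvE.
have P : ((u, v).1 != (u, v).2) && ([set (u, v).1; (u, v).2] \in E').
  by rewrite /= uv.
by exists (Sub (u, v) P); rewrite SubK.
Qed.

Lemma star_swapP (d : D) :
  (((val d).2, (val d).1).1 != ((val d).2, (val d).1).2) &&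
  ([set ((val d).2, (val d).1).1; ((val d).2, (val d).1).2] \in E').
Proof. by case: d => -[u v] /=; rewrite eq_sym setUC. Qed.

Definition star_swap (d : D) : D := Sub ((val d).2, (val d).1) (star_swapP d).

Lemma star_swapK : involutive star_swap.
Proof. by move=> d; apply: val_inj; case: d => -[u v]. Qed.

Lemma star_edge v : v != t0 -> [set t0; v] \in E'.
Proof. by move=> vt; rewrite inE; apply/orP; right; apply: imset_f; rewrite !inE. Qed.

Lemma exists_small_embedding : exists2 g, embeds_with_handles E g & 2 * g <= #|E|.
Proof.
pose rev := perm (can_inj star_swapK).
have revE d : rev d = star_swap d by rewrite permE.
have revK : involutive rev by move=> d; rewrite !revE star_swapK.
have rev_neq d : rev d != d.
  rewrite revE; apply/eqP => /(congr1 val); case: d => -[u v] P /= [vu _].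
  by move: P; rewrite /= vu eqxx.
have [rot rotP] := exists_fibre_perm (fun d : D => (val d).1).
(* A second vertex guarantees a dart at [t0]; the star gives one at every other vertex. *)
have [t1 t1t0] : exists t1, t1 != t0.
  apply/existsP; rewrite -negb_forall; apply/negP => /forallP all0.
  suff : #|T| <= 1 by lia.
  by apply/card_le1_eqP => x y _ _; rewrite (eqP (all0 x)) (eqP (all0 y)).
have t0t1 : t0 != t1 by rewrite eq_sym.
have [d01 d01E] := star_dart t0t1 (star_edge t1t0).
have at_vertex u : exists d : D, (val d).1 = u.
  have [->|ut] := eqVneq u t0; first by exists d01; rewrite d01E.
  have [|d dE] := @star_dart u t0 ut; first by rewrite setUC star_edge.
  by exists d; rewrite dE.
pose r := [rel a b | (rot a == b) || (rev a == b)].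
have c_rot x y : (val x).1 = (val y).1 -> connect r x y.
  move=> exy; have : y \in porbit rot x by rewrite rotP exy.
  case/porbitP => i ->; rewrite permX; elim: i => [|i IH] /=; first exact: connect0.
  by apply: connect_trans IH (connect1 _); rewrite /= eqxx.
have c_rev x : connect r x (rev x) by apply: connect1; rewrite /= eqxx orbT.
have spoke u : u != t0 -> exists2 d : D, val d = (u, t0) & val (rev d) = (t0, u).
  move=> ut; have [|d dE] := @star_dart u t0 ut; first by rewrite setUC star_edge.
  by exists d => //; rewrite revE SubK dE.
have to0 x : connect r x d01.
  have [xt|xt] := eqVneq (val x).1 t0; first by apply: c_rot; rewrite xt d01E.
  have [d dE rdE] := spoke _ xt.
  apply: (@connect_trans _ _ d); first by apply: c_rot; rewrite dE.
  by apply: connect_trans (c_rev d) (c_rot _ _ _); rewrite rdE d01E.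
have from0 y : connect r d01 y.
  have [yt|yt] := eqVneq (val y).1 t0; first by apply: c_rot; rewrite yt d01E.
  have [d dE rdE] := spoke _ yt.
  apply: (@connect_trans _ _ (rev d)); first by apply: c_rot; rewrite rdE d01E.
  apply: connect_trans (c_rev _) (c_rot _ _ _); by rewrite revK dE.
have conn x y : connect r x y := connect_trans (to0 x) (from0 y).
have D0 : 0 < #|{: D}| by apply/card_gt0P; exists d01.
pose M := @OrientedMap D rev rot revK rev_neq D0 conn.
pose f u : {set D} := [set d : D | (val d).1 == u].
have fE (d : D) : f (val d).1 = porbit rot d by apply/setP => x; rewrite inE rotP.
have finj : injective f.
  move=> u v; have [d <-] := at_vertex u; rewrite fE => e.
  have : d \in f v by rewrite -e porbit_id.
  by rewrite inE => /eqP.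
have fV u : f u \in map_vertices M.
  by have [d <-] := at_vertex u; rewrite fE; apply: imset_f.
have drawn : drawn_in E M.
  exists f; split => // u v uvE.
  have uv : u != v by have := E2 uvE; rewrite cards2; case: (u != v).
  have [|d dE] := @star_dart u v uv; first by rewrite inE uvE.
  by exists d; rewrite inE /= ?revE ?SubK dE.
have [g hg] := exists_handles M.
exists g; first by exists M.
have V : #|T| <= #|map_vertices M|.
  rewrite -(card_imset T finj); apply/subset_leq_card/subsetP => _ /imsetP[u _ ->].
  exact: fV.
have F : 0 < #|map_faces M|.
  by apply/card_gt0P; exists (porbit (dart_rev M * dart_rot M)%g d01); apply: imset_f.
have e' : #|map_edges M| <= #|E'|.
  pose h e := odflt set0 (omap (porbit rev) [pick d : D | [set (val d).1; (val d).2] == e]).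
  apply: (@leq_trans #|h @: E'|); last exact: leq_imset_card.
  apply/subset_leq_card/subsetP => _ /imsetP[d _ ->].
  apply/imsetP; exists [set (val d).1; (val d).2].
    by have /andP[] := valP d.
  rewrite /h; case: pickP => [x|/(_ d)]; last by rewrite eqxx.
  move=> /eqP xd /=; apply/eqP; rewrite eq_porbit_mem mem_porbit_invol //.
  rewrite revE -!(inj_eq val_inj) SubK.
  have /andP[] := valP d; have /andP[] := valP x.
  move: xd; case: (val d) => a b; case: (val x) => a' b' /= /setP xd ab' _ ab _.
  have := xd a'; have := xd b'; rewrite !inE !eqxx !orbT /=.
  rewrite !xpair_eqE /= => /esym/orP[]/eqP e1 /esym/orP[]/eqP e2; subst;
    by rewrite ?eqxx ?orbT // in ab' *.
have cE' : #|E'| <= #|E| + #|T|.-1.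
  rewrite (leq_trans (leq_card_setU _ _)) // leq_add2l.
  by rewrite (leq_trans (leq_imset_card _ _)) // cardsC1.
(* With n the number of vertices of the graph: [n + 1 + 2g <= V + F + 2g = #|map_edges M| + 2 <=
   #|E| + n + 1]. *)
move: hg; rewrite /has_handles -addnn; lia.
Qed.

End StarEmbedding.

(** * Expected number of cycles in the random graph *)

Lemma sqr_le_bin2 (R : numDomainType) n : 1 < n ->
  (n%:R ^+ 2 <= 4 * 'C(n, 2)%:R :> R)%R.
Proof.
move=> n2; rewrite -natrX -natrM ler_nat.
by have := mul_bin_left n 1; rewrite bin1; nia.
Qed.

Section CycleEdges.
Variable T : finType.

Definition cycle_edges (c : seq T) : {set {set T}} :=
  [set [set x; next c x] | x in c].

Lemma cycle_edges_sub (E : {set {set T}}) (c : seq T) :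
  path.cycle [rel u v | [set u; v] \in E] c -> cycle_edges c \subset E.
Proof.
by move=> cyc; apply/subsetP => _ /imsetP[x xc ->]; apply: (next_cycle cyc xc).
Qed.

Lemma next_next_neq (c : seq T) x : uniq c -> 2 < size c -> x \in c ->
  next c (next c x) != x.
Proof.
move=> uc c3 xc; have [i c' rc] := rot_to xc.
rewrite -!(next_rot i uc) rc.
have : uniq (x :: c') by rewrite -rc rot_uniq.
have : 2 < size (x :: c') by rewrite -rc size_rot.
case: c' {rc} => [|a [|b c']] //= _; rewrite !inE eqxx.
rewrite !negb_or => /andP[/and3P[xa xb _] _].
by rewrite (eq_sym a x) (negPf xa) eqxx eq_sym.
Qed.

(** Two positions with the same edge would make two steps along the cycle return to the start, which
    length above 2 forbids. *)
Lemma card_cycle_edges (c : seq T) : uniq c -> 2 < size c -> #|cycle_edges c| = size c.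
Proof.
move=> uc c3; rewrite card_in_imset ?(card_uniqP uc) // => x y xc yc /setP e.
have := e x; have := e y; rewrite !inE !eqxx /=.
case/orP => [/eqP //|/eqP yx] /esym/orP[/eqP //|/eqP xy].
by have := next_next_neq uc c3 xc; rewrite -yx -xy eqxx.
Qed.

End CycleEdges.

(** The ratio of the binomials is the product of [(m - i) / (N - i)] over [i < k], and each factor
    is at most [m / N]. *)
Lemma bin_ratio_le k m N : k <= m -> m <= N ->
  'C(N - k, m - k) * N ^ k <= 'C(N, m) * m ^ k.
Proof.
move=> km mN; elim: k km => [|k IH] km; first by rewrite !subn0 !expn0.
have := IH (ltnW km).
have := mul_bin_diag (N - k) (m - k.+1).
rewrite -subnS.
have -> : (m - k.+1).+1 = m - k by lia.
set A := 'C(_, m - k.+1); set B := 'C(_, m - k); set C := 'C(N, m).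
rewrite !expnS => eq le.
rewrite -(@leq_pmul2l (N - k)); last by lia.
have -> : (N - k) * (A * (N * N ^ k)) = ((N - k) * A) * N * N ^ k by lia.
rewrite eq.
apply: (@leq_trans ((N - k) * m * (B * N ^ k))).
  have : (m - k) * N <= (N - k) * m by rewrite !mulnBl; nia.
  move=> h; have := leq_mul h (leqnn (B * N ^ k)); lia.
by have := leq_mul (leqnn ((N - k) * m)) le; lia.
Qed.

Lemma card_pairs n : #|[set e : {set 'I_n} | #|e| == 2]| = 'C(n, 2).
Proof. by rewrite card_draws card_ord. Qed.

Lemma card_graphs n m : #|graphs n m| = 'C('C(n, 2), m).
Proof. by rewrite /graphs cards_draws card_pairs. Qed.

(** Removing [C] is injective on the graphs containing it and leaves [m - #|C|] of the remaining
    pairs. So given edges are all present with probability at most [(m / 'C(n, 2)) ^ #|C|]. *)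
Lemma card_graphs_containing n m (C : {set {set 'I_n}}) : m <= 'C(n, 2) ->
  #|[set E in graphs n m | C \subset E]| * 'C(n, 2) ^ #|C| <= #|graphs n m| * m ^ #|C|.
Proof.
move=> mN.
set P := [set e : {set 'I_n} | #|e| == 2].
have [CP|CP] := boolP (C \subset P); last first.
  have -> : [set E in graphs n m | C \subset E] = set0; last by rewrite cards0.
  apply/setP => E; rewrite !inE.
  apply: contraNF CP => /andP[/andP[EP _] CE]; exact: subset_trans EP.
have [mC|Cm] := ltnP m #|C|.
  have -> : [set E in graphs n m | C \subset E] = set0; last by rewrite cards0.
  apply/setP => E; rewrite !inE.
  apply/negP => /andP[/andP[_ /eqP Em] /subset_leq_card]; rewrite Em; lia.
rewrite card_graphs; apply: leq_trans (bin_ratio_le Cm mN); rewrite leq_mul2r.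
apply/orP; right.
have -> : 'C(n, 2) - #|C| = #|P :\: C| by rewrite cardsD (setIidPr CP) card_pairs.
rewrite -cards_draws.
have inj : {in [set E in graphs n m | C \subset E] &,
    injective (fun E : {set {set 'I_n}} => E :\: C)}.
  move=> A B; rewrite !inE => /andP[_ CA] /andP[_ CB] e.
  rewrite -[LHS](setID _ C) -[RHS](setID _ C) (setIidPr CA) (setIidPr CB).
  by congr (_ :|: _).
rewrite -(card_in_imset inj); apply/subset_leq_card/subsetP => _ /imsetP[E + ->].
rewrite !inE => /andP[/andP[EP /eqP Em] CE].
by rewrite setSD //= cardsD (setIidPr CE) Em eqxx.
Qed.

(** Double counting: there are at most [n ^ k] vertex sequences, and each requires [k] distinct
    edges. *)
Lemma sum_simple_cycles n m k : m <= 'C(n, 2) -> 2 < k ->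
  (\sum_(E in graphs n m) #|simple_cycles (adjacency E) k|) * 'C(n, 2) ^ k
    <= #|graphs n m| * (n * m) ^ k.
Proof.
move=> mN k3.
under eq_bigr do rewrite -sum1_card.
rewrite (exchange_big_dep (fun c : k.-tuple 'I_n => uniq c)) /=; last first.
  by move=> E c _; rewrite inE => /andP[].
rewrite big_distrl /=.
apply: (@leq_trans (\sum_(c : k.-tuple 'I_n | uniq c) #|graphs n m| * m ^ k)).
  apply: leq_sum => c uc.
  have ck : #|cycle_edges c| = k by rewrite card_cycle_edges ?size_tuple.
  have := card_graphs_containing (cycle_edges c) mN; rewrite ck.
  apply: leq_trans; rewrite leq_mul2r; apply/orP; right.
  rewrite sum1dep_card; apply/subset_leq_card/subsetP => E.
  rewrite !inE => /andP[-> /andP[_]] /=; exact: cycle_edges_sub.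
rewrite sum_nat_const expnMn mulnCA leq_mul2l; apply/orP; right.
rewrite leq_mul2r; apply/orP; right.
apply: leq_trans (max_card _) _; by rewrite card_tuple card_ord.
Qed.

From mathcomp Require Import all_classical all_reals all_analysis ring lra.
Import numFieldNormedType.Exports.

(** * Markov's inequality and the limit *)

(** The star embedding shows that some genus is attained, so [genus] is a true minimum and not its
    default. *)
Lemma genus_spec n m (E : {set {set 'I_n}}) : 1 < n -> E \in graphs n m ->
  embeds_with_handles E (genus E) /\ 2 * genus E <= m.
Proof.
move=> n2; rewrite inE => /andP[/fintype.subsetP EP /eqP <-].
have E2 e : e \in E -> #|e| = 2 by move=> /EP; rewrite inE => /eqP.
have [|g Eg gm] := exists_small_embedding (Ordinal (ltnW n2)) E2.
  by rewrite card_ord.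
have ex : exists h, `[< embeds_with_handles E h >] by exists g; apply/asboolP.
have [h /asboolP Eh hmin] := ex_minnP ex.
have [Egen genmin] : is_genus E (genus E).
  rewrite /genus; apply: xgetPex; exists h; split=> // k Ek.
  exact/hmin/asboolP.
by split=> //; apply: leq_trans gm; rewrite leq_mul2l genmin.
Qed.

Definition short_cycles (T : finType) (E : {set {set T}}) (L : nat) : nat :=
  \sum_(k < L.+1 | 2 < k) #|simple_cycles (adjacency E) k|.

Local Open Scope ring_scope.

(** Divides the double count by ['C(n, 2) ^ k], using [n * m / 'C(n, 2) <= 4 * m / n]. *)
Lemma mean_simple_cycles (R : realFieldType) n m k :
  (1 < n)%N -> (m <= 'C(n, 2))%N -> (2 < k)%N ->
  (\sum_(E in graphs n m) #|simple_cycles (adjacency E) k|)%N%:R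
    <= #|graphs n m|%:R * (4 * m%:R / n%:R) ^+ k :> R.
Proof.
move=> n2 mN k3; have := sum_simple_cycles mN k3.
set S := (\sum_(E in _) _)%N; set G := #|_| => H.
have n0 : 0 < n%:R :> R by rewrite ltr0n; lia.
have hNR : n%:R ^+ 2 <= 4 * 'C(n, 2)%:R :> R by apply: sqr_le_bin2.
have N0 : 0 < 'C(n, 2)%:R :> R by rewrite ltr0n bin_gt0.
rewrite -(@ler_pM2r _ ('C(n, 2)%:R ^+ k)) ?exprn_gt0 //.
have HR : S%:R * 'C(n, 2)%:R ^+ k <= G%:R * (n%:R * m%:R) ^+ k :> R.
  by rewrite -!natrX -!natrM -natrX -natrM ler_nat.
apply: (le_trans HR).
rewrite -[leRHS]mulrA ler_wpM2l ?ler0n // -exprMn.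
apply: lerXn2r; rewrite ?nnegrE ?mulr_ge0 ?invr_ge0 ?ler0n //.
rewrite -(@ler_pM2r _ n%:R) //.
have -> : 4 * m%:R / n%:R * 'C(n, 2)%:R * n%:R = m%:R * (4 * 'C(n, 2)%:R) :> R.
  by field; rewrite gt_eqF.
rewrite mulrAC -expr2 mulrC ler_wpM2l //.
Qed.

(** As [n <= m], the base [4 * m / n] is at least 1, so each of the at most [L.+1] terms is bounded
    by the top power. *)
Lemma mean_short_cycles (R : realFieldType) n m L :
  (1 < n <= m)%N -> (m <= 'C(n, 2))%N ->
  (\sum_(E in graphs n m) short_cycles E L)%N%:R
    <= #|graphs n m|%:R * (L.+1%:R * (4 * m%:R / n%:R) ^+ L) :> R.
Proof.
move=> /andP[n2 nm] mN; rewrite /short_cycles exchange_big /= natr_sum.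
have q1 : 1 <= 4 * m%:R / n%:R :> R.
  rewrite ler_pdivlMr ?mul1r ?ltr0n; last by lia.
  by rewrite -natrM ler_nat; lia.
have -> : #|graphs n m|%:R * (L.+1%:R * (4 * m%:R / n%:R) ^+ L) =
    \sum_(k < L.+1) #|graphs n m|%:R * (4 * m%:R / n%:R) ^+ L :> R.
  by rewrite sumr_const card_ord -[RHS]mulr_natl mulrCA.
rewrite big_mkcond /=; apply: ler_sum => k _.
case: ifP => k3; last by rewrite mulr_ge0 // exprn_ge0 // (le_trans ler01).
apply: le_trans (mean_simple_cycles _ n2 mN k3) _.
rewrite ler_wpM2l // ler_weXn2l //; have := ltn_ord k; lia.
Qed.

(** The loss [eps * m] is split: a quarter for long faces ([2 / L <= eps / 4]), a quarter for
    [2 * n], and half for short cycles. *)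
Lemma genus_lower_of_few_cycles (R : realFieldType) (eps : R) n m L
    (E : {set {set 'I_n}}) : (1 < n)%N -> E \in graphs n m ->
  8 <= eps * L%:R -> n%:R <= eps / 8 * m%:R ->
  (short_cycles E L)%:R <= eps / 2 * m%:R ->
  (1 - eps) * (m%:R / 2) <= (genus E)%:R.
Proof.
move=> n2 EG L8 nm cyc; have [Eg _] := genus_spec n2 EG.
move: EG; rewrite inE => /andP[/fintype.subsetP EP /eqP Em].
have E2 e : e \in E -> #|e| = 2%N by move=> /EP; rewrite inE => /eqP.
have := embedding_lower_bound L E2 Eg; rewrite -/(short_cycles E L) Em card_ord.
rewrite -(ler_nat R) !(natrM, natrD) => H.
have L0 : 0 < L%:R :> R.
  by rewrite lt_neqAle ler0n andbT; apply: contraTneq L8 => <-; rewrite mulr0 -ltNge.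
rewrite -(@ler_pM2r _ L%:R) //.
set g := (genus E)%:R in H *; set X := (short_cycles E L)%:R in H cyc *.
set M := m%:R in H nm cyc *; set l := L%:R in H L8 L0 *; set N := n%:R in H nm *.
have M0 : 0 <= M by rewrite ler0n.
have h1 : N * l <= eps / 8 * M * l by rewrite ler_pM2r.
have h2 : X * l <= eps / 2 * M * l by rewrite ler_pM2r.
have h3 : 8 * M <= eps * l * M by rewrite ler_wpM2r.
nra.
Qed.

Lemma Pr_genus_ge (R : realType) (eps : R) n m L : 0 < eps ->
  (1 < n <= m)%N -> (m <= 'C(n, 2))%N ->
  8 <= eps * L%:R -> n%:R <= eps / 8 * m%:R ->
  1 - L.+1%:R * (4 * m%:R / n%:R) ^+ L / (eps / 2 * m%:R) <=
  Pr_Gnm R n m (fun E =>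
      (1 - eps) * (m%:R / 2) <= ((genus E)%:R : R) <= m%:R / 2) <= 1.
Proof.
move=> eps0 /andP[n2 nm] mN L8 nem; set A := fun E => _.
have G0 : 0 < #|graphs n m|%:R :> R by rewrite ltr0n card_graphs bin_gt0.
have m0 : 0 < m%:R :> R by rewrite ltr0n; lia.
have e0 : 0 < eps / 2 * m%:R by rewrite mulr_gt0 // divr_gt0.
pose bad := [set E in graphs n m | ~~ A E]%SET.
pose good := [set E in graphs n m | A E]%SET.
have gb : (#|good| + #|bad| = #|graphs n m|)%N.
  rewrite -(cardsID [set E | A E]%SET (graphs n m)); congr (_ + _)%N.
    by apply: eq_card => E; rewrite !inE.
  by apply: eq_card => E; rewrite !inE andbC.
(* Markov: the upper bound on the genus always holds, so a bad graph violates the lower one and has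
   at least [eps / 2 * m] short cycles. *)
have badle : #|bad|%:R * (eps / 2 * m%:R) <=
    #|graphs n m|%:R * (L.+1%:R * (4 * m%:R / n%:R) ^+ L).
  apply: le_trans (mean_short_cycles _ _ _ mN); last by rewrite n2.
  rewrite natr_sum [X in _ <= X](bigID (fun E => A E)) /= mulr_natl -sumr_const.
  rewrite -[X in X <= _]add0r; apply: lerD.
    by apply: sumr_ge0 => E _; rewrite ler0n.
  rewrite [X in _ <= X](eq_bigl (mem bad)); last by move=> E; rewrite !inE.
  apply: ler_sum => E; rewrite inE => /andP[EG].
  rewrite leNgt; apply: contra => /ltW few; rewrite /A.
  rewrite (genus_lower_of_few_cycles n2 EG L8 nem few) /=.
  have [_] := genus_spec n2 EG; rewrite -(ler_nat R) natrM; lra.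
rewrite /Pr_Gnm -/good; apply/andP; split; last first.
  by rewrite ler_pdivrMr // mul1r ler_nat; lia.
rewrite ler_pdivlMr // mulrBl mul1r lerBlDr -gb natrD lerD2l.
rewrite -natrD gb -(ler_pM2r e0); apply: le_trans badle _.
by rewrite [leRHS]mulrAC divfK ?gt_eqF // mulrC.
Qed.

Local Open Scope classical_set_scope.

Theorem theorem1p1 (R : realType) (m : nat -> nat)
  (m_superlinear : n%:R / (m n)%:R @[n --> \oo] --> (0 : R))
  (m_exponent : exists delta : nat -> R,
     delta n @[n --> \oo] --> (0 : R) /\
     \forall n \near \oo, (m n)%:R = n%:R `^ (1 + delta n)) :
  forall eps : R, 0 < eps ->
    Pr_Gnm R n (m n) (fun E =>
      (1 - eps) * ((m n)%:R / 2) <= ((genus E)%:R : R) <= (m n)%:R / 2)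
      @[n --> \oo] --> (1 : R).
Proof.
move=> eps eps0; have [delta [delta0 mE]] := m_exponent.
have [L L8] : exists L : nat, 8 <= eps * L%:R.
  exists (Num.truncn (8 / eps)).+1; rewrite mulrC -ler_pdivrMr //.
  exact/ltW/truncnS_gt.
have L0 : (0 < L)%N.
  by case: L L8 => //; rewrite mulr0 => /le_lt_trans/(_ (ltr0n R 8)); rewrite ltxx.
(* The failure probability will be at most [C * (n ^ delta) ^ L / m]. *)
pose C : R := L.+1%:R * 4 ^+ L / (eps / 2).
have C0 : 0 < C by rewrite divr_gt0 ?divr_gt0 // mulr_gt0 // exprn_gt0.
apply/cvgrPdist_le => e e0.
near=> n.
have n16 : (16 <= n)%N by near: n; exact: nbhs_infty_ge.
have n_gt1 : (1 < n)%N by exact: leq_trans n16.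
(* This makes [C / sqrt n] at most [e]. *)
have nC : (C / e) ^+ 2 <= n%:R.
  near: n; exact: nbhs_infty_ger.
have nm1 : `|0 - n%:R / (m n)%:R| < Num.min 1 (eps / 8) :> R.
  near: n; move/cvgrPdist_lt: m_superlinear; apply.
  by rewrite lt_min ltr01 divr_gt0.
(* With this bound [(n ^ delta) ^ L] is at most [sqrt n]. *)
have dn : `|0 - delta n| < (2 * L%:R)^-1.
  near: n; move/cvgrPdist_lt: delta0; apply.
  by rewrite invr_gt0 mulr_gt0 // ltr0n.
have mn : (m n)%:R = n%:R `^ (1 + delta n) by near: n.
have n0 : 0 < n%:R :> R by rewrite ltr0n; lia.
have n1 : 1 <= n%:R :> R by rewrite ler1n; lia.
have m0 : 0 < (m n)%:R :> R by rewrite mn powR_gt0.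
rewrite sub0r normrN ger0_norm ?divr_ge0 ?ler0n // lt_min in nm1.
rewrite !ltr_pdivrMr // mul1r ltr_nat in nm1.
move: nm1 => /andP[/ltnW nm nem].
pose s : R := Num.sqrt n%:R.
have s2 : s ^+ 2 = n%:R by rewrite sqr_sqrtr // ler0n.
have s0 : 0 < s by rewrite sqrtr_gt0.
have s4 : 4 <= s.
  rewrite leNgt; apply/negP => s4.
  have : s ^+ 2 < 16 by rewrite expr2; nra.
  by rewrite s2 ltNge (ler_nat _ 16) n16.
have sC : C / e <= s.
  rewrite leNgt; apply/negP => sC.
  have : s ^+ 2 < (C / e) ^+ 2 by rewrite ltrXn2r // ?nnegrE ltW // divr_gt0.
  by rewrite s2 ltNge nC.
rewrite sub0r normrN in dn.
have L1 : 1 <= L%:R :> R by rewrite ler1n.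
have dL : delta n * L%:R <= 2^-1.
  have /ltW : `|delta n| * (2 * L%:R) < 1.
    by rewrite -ltr_pdivlMr ?mul1r // mulr_gt0 // (lt_le_trans ltr01).
  have := ler_norm (delta n); nra.
have d12 : delta n <= 2^-1.
  have : `|delta n| <= 2^-1.
    apply: (le_trans (ltW dn)); rewrite lef_pV2 ?posrE ?mulr_gt0 //; first lra.
    exact: lt_le_trans ltr01 L1.
  by have := ler_norm (delta n); lra.
have mE' : (m n)%:R = n%:R * n%:R `^ delta n.
  rewrite mn powRD; last by rewrite (gt_eqF n0) /= ?implybT ?orbT.
  by rewrite powRr1 // ler0n.
have q : 4 * (m n)%:R / n%:R = 4 * n%:R `^ delta n.
  by rewrite mE'; field; rewrite gt_eqF.
have qL : (n%:R `^ delta n) ^+ L <= s.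
  rewrite -powR_mulrn ?powR_ge0 // -powRrM.
  rewrite /s -powR12_sqrt ?ler0n //; exact: ler_powR.
(* Here [m <= n * s = s ^ 3], and [4 <= s] gives [4 * s ^ 3 <= s ^ 4 = n ^ 2 <= 4 * 'C(n, 2)]. *)
have mN : (m n <= 'C(n, 2))%N.
  rewrite -(ler_nat R).
  have := sqr_le_bin2 R n_gt1.
  have : (m n)%:R <= n%:R * s.
    rewrite mE' ler_pM2l //; rewrite /s -powR12_sqrt ?ler0n //; exact: ler_powR.
  rewrite -s2 => h1 h2; nra.
have n2 : (1 < n <= m n)%N by rewrite nm n_gt1.
have /andP[lo hi] := @Pr_genus_ge R eps n (m n) L eps0 n2 mN L8 (ltW nem).
rewrite ger0_norm ?subr_ge0 // lerBlDr -lerBlDl.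
apply: le_trans lo; rewrite lerD2l lerN2 q exprMn.
have -> : L.+1%:R * (4 ^+ L * (n%:R `^ delta n) ^+ L) / (eps / 2 * (m n)%:R) =
   C * ((n%:R `^ delta n) ^+ L / (m n)%:R).
  by rewrite /C; field; rewrite !gt_eqF.
(* The numerator is at most [s], and [m >= n = s ^ 2]. *)
have : (n%:R `^ delta n) ^+ L / (m n)%:R <= s^-1.
  rewrite ler_pdivrMr //; apply: (le_trans qL).
  rewrite -ler_pdivrMl ?invr_gt0 // invrK -expr2 s2 ler_nat //.
move/(ler_wpM2l (ltW C0))/le_trans; apply.
by rewrite ler_pdivrMr // mulrC -ler_pdivrMr.
Unshelve. all: by end_near.
Qed.
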